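(* Let $k\ge 2$ and $T\ge 1$ be integers. Let $\mathcal{U}_t^k=\{U_t^{(1)},\ldots,U_t^{(k)}\}$, $t=1,\ldots,T$, be $T$ mutually independent sets, each of which is a set of negatively associated (NA) random variables. Let $\mathcal{X}_0^k=\{X_0^{(1)},\ldots,X_0^{(k)}\}$ be a random initial state, independent of $\{\mathcal{U}_t^k\}_{1\le t\le T}$, and define for $t=1,\ldots,T$ and $j=1,\ldots,k$ $$X_t^{(j)}=\psi_t\big(X_{t-1}^{(j)},U_t^{(j)}\big).$$ Assume that $\psi_t(X,U)$ is nondecreasing (in all of its arguments) for every $t\le T$. Then: (i) The $k$-tuple $\{X_{t_1}^{(1)},\ldots,X_{t_k}^{(k)}\}$ is a collection of $k$ NA variables for every $(t_1,\ldots,t_k)\in\{0,1,\ldots,T\}^k$ if and only if it is so for $t_1=\cdots=t_k=0$. (ii) Assume that $\mathcal{X}_0^k$ is a set of NA variables. Let $f$ be any monotone real function such that $f(X_t^{(j)})$ has finite variance for all $t\in\{1,\dots,T\}$ and $j\in\{1,\dots,k\}$ and such that $\sum_{j=1}^k\mathrm{Var}\big(\sum_{t=1}^T f(X_t^{(j)})\big)>0$. Then the variance reduction factor $$S_k^{(f)}=1+\frac{\sum_{j_1\neq j_2}\mathrm{Cov}\Big(\sum_{t=1}^{T} f(X_t^{(j_1)}),\sum_{t=1}^{T} f(X_t^{(j_2)})\Big)}{\sum_{j=1}^{k}\mathrm{Var}\Big(\sum_{t=1}^{T} f(X_t^{(j)})\Big)}$$ satisfies $S_k^{(f)}\le 1$,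 and $S_k^{(f)}<1$ if and only if at least one of the between-chain covariances $$\beta^{(f)}_{t_1,t_2;j_1,j_2}=\mathrm{Cov}\big(f(X_{t_1}^{(j_1)}),f(X_{t_2}^{(j_2)})\big),\qquad j_1\ne j_2\in\{1,\ldots,k\},\ t_1,t_2\in\{1,\ldots,T\},$$ is strictly negative.
   Context: All random variables $X_t^{(j)}$, $U_t^{(j)}$ may be real-valued or take values in finite-dimensional real spaces. A (measurable) function on $\mathbf{R}^n$ is called nondecreasing if it is nondecreasing in each of its arguments (for vector-valued functions such as $\psi_t$, each output coordinate is nondecreasing); it is monotone if it is nondecreasing or nonincreasing in this sense. Negative association: random variables $\{X_i\}_{1\le i\le n}$, where each $X_i$ can be of arbitrary dimension, are said to be negatively associated (NA) if for every pair of disjoint finite subsets $A_1,A_2$ of $\{1,\ldots,n\}$ and for any nondecreasing real functions $f_1,f_2$, $$\mathrm{Cov}\big(f_1(X_i,i\in A_1),f_2(X_j,j\in A_2)\big)\le 0$$ whenever this covariance is well defined. *)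

(* Defs.v *)
From mathcomp Require Export all_boot all_order all_algebra.
From mathcomp Require Export all_classical all_reals all_analysis.

Set Implicit Arguments.
Unset Strict Implicit.
Unset Printing Implicit Defensive.

Import Order.TTheory GRing.Theory Num.Theory.
Import numFieldNormedType.Exports.

Local Open Scope classical_set_scope.
Local Open Scope ring_scope.

Section monotone_functions.
Context {d} {R : realType} {V : measurableType d} {I : Type}.

(* The scalar arguments of a function on V are read off by [c : V -> I -> R],
   which is one of [coord1], [coord2], [coord_pair] below. *)
Definition nondecreasing_args (c : V -> I -> R) (f : V -> R) : Prop :=
  measurable_fun [set: V] f /\
  forall (x y : V) (i : I), c x i <= c y i ->
    (forall j, j <> i -> c x j = c y j) -> f x <= f y.

Definition nonincreasing_args (c : V -> I -> R) (f : V -> R) : Prop :=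
  measurable_fun [set: V] f /\
  forall (x y : V) (i : I), c x i <= c y i ->
    (forall j, j <> i -> c x j = c y j) -> f y <= f x.

Definition monotone_args (c : V -> I -> R) (f : V -> R) : Prop :=
  nondecreasing_args c f \/ nonincreasing_args c f.

End monotone_functions.

Section coordinates.
Context {R : realType}.

Definition coord1 {p : nat} (x : p.-tuple R) (i : 'I_p) : R := tnth x i.

Definition coord2 {m p : nat} (x : m.-tuple (p.-tuple R)) (i : 'I_m * 'I_p) : R :=
  tnth (tnth x i.1) i.2.

Definition coord_pair {p q : nat} (x : p.-tuple R * q.-tuple R)
    (i : 'I_p + 'I_q) : R :=
  match i with inl l => tnth x.1 l | inr m => tnth x.2 m end.

End coordinates.

Section probability_notions.
Context {d} {Omega : measurableType d} {R : realType} (P : probability Omega R).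

(* (X_i, i \in A), listed in increasing order of the indices. *)
Definition subfamily {n p : nat} (X : 'I_n -> Omega -> p.-tuple R)
    (A : {set 'I_n}) (w : Omega) : #|A|.-tuple (p.-tuple R) :=
  [tuple X (enum_val i) w | i < #|A|].

(* The covariance is well defined when both variables and their product are
   integrable. *)
Definition negatively_associated {n p : nat}
    (X : 'I_n -> Omega -> p.-tuple R) : Prop :=
  (forall i, measurable_fun [set: Omega] (X i)) /\
  forall (A1 A2 : {set 'I_n}), A1 :&: A2 = finset.set0 ->
  forall (f1 : #|A1|.-tuple (p.-tuple R) -> R)
         (f2 : #|A2|.-tuple (p.-tuple R) -> R),
    nondecreasing_args coord2 f1 -> nondecreasing_args coord2 f2 ->
    let Y1 := f1 \o subfamily X A1 in
    let Y2 := f2 \o subfamily X A2 in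
    Y1 \in Lfun P 1 -> Y2 \in Lfun P 1 -> (Y1 \* Y2) \in Lfun P 1 ->
    (covariance P Y1 Y2 <= 0)%E.

Definition generated_sigma_algebra {I : Type} {p : I -> nat}
    (V : forall i, Omega -> (p i).-tuple R) : set_system Omega :=
  <<s \bigcup_i preimage_set_system [set: Omega] (V i) measurable >>.

Definition independent2 (F G : set_system Omega) : Prop :=
  forall A B, F A -> G B -> P (A `&` B) = (P A * P B)%E.

Definition mutually_independent {I : finType} (F : I -> set_system Omega) : Prop :=
  forall (J : {set I}) (B : I -> set Omega),
    (forall i, i \in J -> F i (B i)) ->
    P (\bigcap_(i in [set` J]) B i) = (\prod_(i in J) P (B i))%E.

(* Only the values [psi t], [U t] with t >= 1 are used. *)
Fixpoint chain {k p : nat} {q : nat -> nat}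
    (psi : forall t, p.-tuple R * (q t).-tuple R -> p.-tuple R)
    (X0 : 'I_k -> Omega -> p.-tuple R)
    (U : forall t, 'I_k -> Omega -> (q t).-tuple R)
    (t : nat) (j : 'I_k) (w : Omega) : p.-tuple R :=
  match t with
  | 0%N => X0 j w
  | s.+1 => psi s.+1 (chain psi X0 U s j w, U s.+1 j w)
  end.

(* Sum over the times 1, ..., T; time 0 is excluded. *)
Definition time_sum (T : nat) (Y : nat -> Omega -> R) (w : Omega) : R :=
  \sum_(1 <= t < T.+1) Y t w.

(* [fine] is harmless: all the covariances are finite when the Y t j have
   finite variance. *)
Definition variance_reduction_factor (k T : nat)
    (Y : nat -> 'I_k -> Omega -> R) : R :=
  let S j := time_sum T (Y ^~ j) in
  1 + (\sum_(j1 < k) \sum_(j2 < k | j1 != j2) fine (covariance P (S j1) (S j2)))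
      / (\sum_(j < k) fine 'V_P[S j]).

End probability_notions.

(* Main.v *)
(**
  Every X_{t_j}^{(j)} is a nondecreasing function of X_0^{(j)} and of the
  U_s^{(j)}, s <= t_j.  Truncating the times at s, the chains advance one
  independent NA family at a time: (X_{min(t_j,s+1)}^{(j)})_j is a coordinatewise
  nondecreasing image of the pair formed by (X_{min(t_j,s)}^{(j)})_j and the
  independent family (U_{s+1}^{(j)})_j.  Conditioning on the latter, the product of
  two test functions integrates to at most the product of their conditional means
  (NA of the former), and these conditional means are again nondecreasing functions
  of disjoint sets of coordinates (NA of the latter).  To keep the conditional means
  everywhere defined, this is done for bounded nonnegative test functions; the
  general case follows by clipping and dominated convergence.

  Part (ii) is bilinearity of the covariance: the numerator of the variance reduction
  factor is a sum of between-chain covariances, each nonpositive by (i).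
*)

From HB Require Import structures.
From mathcomp Require Import measurable_realfun.
From mathcomp Require Import ring lra.
Require Import Defs.

Set Implicit Arguments.
Unset Strict Implicit.
Unset Printing Implicit Defensive.

Import Order.TTheory GRing.Theory Num.Theory.
Import numFieldNormedType.Exports.

Local Open Scope classical_set_scope.
Local Open Scope ring_scope.

(** * Monotonicity in each argument versus the product order *)

(** For the nontrivial direction, the coordinates of [x] are replaced by those of [y] one at a time,
    each replacement comparing two points that differ in a single argument. The map [mk] supplies
    the intermediate points, and finiteness of [I] ends the process. *)
Lemma nondecreasing_argsP d (R : realType) (V : measurableType d) (I : finType)
    (c : V -> I -> R) (mk : (I -> R) -> V) (f : V -> R) :
  cancel mk c -> cancel c mk ->
  nondecreasing_args c f <->
  measurable_fun [set: V] f /\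
  forall x y : V, (forall i, c x i <= c y i) -> f x <= f y.
Proof.
move=> mkK cK; split=> -[mf fmono]; split => //; last first.
  move=> x y i xyi xyj; apply: fmono => j.
  by have [->|/eqP/xyj ->] := eqVneq j i.
(* Induction on the number of coordinates at which [x] and [y] differ. *)
move=> x y; have [n] := ubnP #|[pred i | c x i != c y i]|.
elim: n x => // n IH x /ltnSE sn xy.
case: (pickP [pred i | c x i != c y i]) => [i /= ixy|xyE]; last first.
  suff -> : x = y by [].
  by apply: (can_inj cK); apply: funext => i; apply/eqP; have /negbFE := xyE i.
pose z := mk (fun j => if j == i then c y i else c x j).
have cz j : c z j = if j == i then c y i else c x j by rewrite mkK.
apply: (@le_trans _ _ (f z)).
  apply: (fmono _ _ i) => [|j /eqP/negbTE ji]; first by rewrite cz eqxx; exact: xy.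
  by rewrite cz ji.
apply: IH => [|j]; last first.
  by rewrite cz; case: eqP => [->|_]; [exact: lexx|exact: xy].
apply: leq_trans sn; apply: proper_card; apply/properP; split.
  apply/fintype.subsetP => j; rewrite !inE cz.
  by case: (eqVneq j i) => [->|//]; rewrite eqxx.
by exists i; rewrite !inE ?cz ?eqxx.
Qed.

Section coordinate_readers.
Context {R : realType}.

Lemma nondecreasing_coord1P p (f : p.-tuple R -> R) :
  nondecreasing_args coord1 f <->
  measurable_fun setT f /\
  forall x y, (forall l, tnth x l <= tnth y l) -> f x <= f y.
Proof.
apply: (nondecreasing_argsP (mk := fun g => [tuple g i | i < p])).
  by move=> g; apply: funext => i; rewrite /coord1 tnth_mktuple.
by move=> x; apply: eq_from_tnth => i; rewrite tnth_mktuple.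
Qed.

Lemma nondecreasing_coord2P m p (f : m.-tuple (p.-tuple R) -> R) :
  nondecreasing_args coord2 f <->
  measurable_fun setT f /\
  forall x y, (forall i l, tnth (tnth x i) l <= tnth (tnth y i) l) -> f x <= f y.
Proof.
have mkP := @nondecreasing_argsP _ R _ _ coord2
  (fun g : 'I_m * 'I_p -> R => [tuple [tuple g (i, l) | l < p] | i < m]) f.
split=> [/mkP[||mf fm]|[mf fm]].
- by move=> g; apply: funext => -[i l]; rewrite /coord2 !tnth_mktuple.
- move=> x; apply: eq_from_tnth => i; rewrite tnth_mktuple.
  by apply: eq_from_tnth => l; rewrite tnth_mktuple.
- by split=> // x y xy; apply: fm => -[i l]; exact: xy.
- apply/mkP.
  + by move=> g; apply: funext => -[i l]; rewrite /coord2 !tnth_mktuple.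
  + move=> x; apply: eq_from_tnth => i; rewrite tnth_mktuple.
    by apply: eq_from_tnth => l; rewrite tnth_mktuple.
  + by split=> // x y xy; apply: fm => i l; exact: (xy (i, l)).
Qed.

Lemma nondecreasing_coord_pairP p q (f : p.-tuple R * q.-tuple R -> R) :
  nondecreasing_args coord_pair f <->
  measurable_fun setT f /\
  forall x y u v, (forall l, tnth x l <= tnth y l) ->
    (forall l, tnth u l <= tnth v l) -> f (x, u) <= f (y, v).
Proof.
have mkP := @nondecreasing_argsP _ R _ _ coord_pair
  (fun g : 'I_p + 'I_q -> R =>
    ([tuple g (inl l) | l < p], [tuple g (inr l) | l < q])) f.
have mkK : cancel (fun g : 'I_p + 'I_q -> R =>
    ([tuple g (inl l) | l < p], [tuple g (inr l) | l < q])) coord_pair.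
  by move=> g; apply: funext => -[l|l]; rewrite /coord_pair tnth_mktuple.
have cK : cancel coord_pair (fun g : 'I_p + 'I_q -> R =>
    ([tuple g (inl l) | l < p], [tuple g (inr l) | l < q])).
  by move=> [x u]; congr pair; apply: eq_from_tnth => l; rewrite tnth_mktuple.
split=> [/(mkP mkK cK)|] [mf fm]; [split=> //|apply/(mkP mkK cK); split=> //].
  by move=> x y u v xy uv; apply: fm => -[l|l] /=.
move=> [x u] [y v] xy; apply: fm => l.
  exact: (xy (inl l)).
exact: (xy (inr l)).
Qed.

End coordinate_readers.

(** * Bounded test functions and negative association in product form *)

Section tests.
Context {R : realType}.

(* Monotonicity in the coordinates of [A] alone also says that [F] does not
   depend on the others. *)
Definition bounded_test k p (A : {set 'I_k})
    (F : k.-tuple (p.-tuple R) -> R) : Prop :=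
  [/\ measurable_fun setT F, forall x, 0 <= F x,
      exists M, forall x, F x <= M &
      forall x y, (forall i l, i \in A -> tnth (tnth x i) l <= tnth (tnth y i) l) ->
        F x <= F y].

Context d (Omega : measurableType d) (P : probability Omega R).

(** The covariance inequality is written with a product of integrals, so that Tonelli applies to the
    nonnegative tests without integrability conditions. Tests read the whole [k]-tuple, which keeps
    the index sets out of the types. *)
Definition bounded_NA k p (Z : Omega -> k.-tuple (p.-tuple R)) : Prop :=
  forall A1 A2 : {set 'I_k}, A1 :&: A2 = finset.set0 ->
  forall F1 F2, bounded_test A1 F1 -> bounded_test A2 F2 ->
  (\int[P]_w (F1 (Z w) * F2 (Z w))%:E <=
   \int[P]_w (F1 (Z w))%:E * \int[P]_w (F2 (Z w))%:E)%E.

Definition joined k p (X : 'I_k -> Omega -> p.-tuple R) (w : Omega) :=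
  [tuple X i w | i < k].

Lemma measurable_joined k p (X : 'I_k -> Omega -> p.-tuple R) :
  (forall i, measurable_fun setT (X i)) -> measurable_fun setT (joined X).
Proof.
move=> mX; apply/measurable_fun_tnthP => i.
by apply: eq_measurable_fun (mX i) => w _; rewrite /= tnth_mktuple.
Qed.

Lemma bounded_Lfun1 (Y : Omega -> R) M : measurable_fun setT Y ->
  (forall w, `|Y w| <= M) -> Y \in Lfun P 1.
Proof.
move=> mY YM; apply/Lfun1_integrable.
apply: (@le_integrable _ _ _ _ _ _ _ (EFin \o cst M)) => //.
- exact/measurable_EFinP.
- move=> w _; rewrite /= lee_fin; exact: le_trans (YM w) (ler_norm _).
- exact/Lfun1_integrable/Lfun_cst.
Qed.

End tests.

(** * Equivalence of negative association with its bounded form *)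

Section NA_bounded.
Context {R : realType} d (Omega : measurableType d) (P : probability Omega R).

(* Coordinates outside [A] are padded with zeros. *)
Definition extend k p (A : {set 'I_k}) (t : #|A|.-tuple (p.-tuple R)) :
    k.-tuple (p.-tuple R) :=
  [tuple nth [tuple 0 | l < p] t (index i (enum A)) | i < k].

Definition restrict k p (A : {set 'I_k}) (z : k.-tuple (p.-tuple R)) :
    #|A|.-tuple (p.-tuple R) :=
  [tuple tnth z (enum_val i) | i < #|A|].

Lemma restrict_joined k p (X : 'I_k -> Omega -> p.-tuple R) A w :
  restrict A (joined X w) = subfamily X A w.
Proof. by apply: eq_from_tnth => i; rewrite !tnth_mktuple. Qed.

Lemma tnth_extend_subfamily k p (X : 'I_k -> Omega -> p.-tuple R)
    (A : {set 'I_k}) w i : i \in A ->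
  tnth (extend (subfamily X A w)) i = X i w.
Proof.
move=> iA; rewrite tnth_mktuple.
have iA' : (index i (enum A) < #|A|)%N by rewrite cardE index_mem mem_enum.
rewrite -[index _ _]/(nat_of_ord (Ordinal iA')) -tnth_nth tnth_mktuple.
by congr X; rewrite (enum_val_nth i) nth_index // mem_enum.
Qed.

Lemma measurable_restrict k p (A : {set 'I_k}) :
  measurable_fun setT (@restrict k p A).
Proof.
apply/measurable_fun_tnthP => i.
apply: eq_measurable_fun (measurable_tnth (enum_val i)) => w _.
by rewrite /= tnth_mktuple.
Qed.

Lemma measurable_extend k p (A : {set 'I_k}) :
  measurable_fun setT (@extend k p A).
Proof.
apply/measurable_fun_tnthP => i.
have [iA|iA] := ltnP (index i (enum A)) #|A|.
  apply: eq_measurable_fun (measurable_tnth (Ordinal iA)) => w _.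
  by rewrite /= tnth_mktuple (tnth_nth [tuple 0 | l < p]).
apply: eq_measurable_fun (measurable_cst [tuple (0 : R) | l < p]) => w _.
by rewrite /= tnth_mktuple nth_default // size_tuple.
Qed.

(** Turns a test on whole tuples into a function of the subfamily indexed by [A], as the definition
    of negative association requires. The padded coordinates are never compared. *)
Lemma nondecreasing_extend k p (A : {set 'I_k}) (F : k.-tuple (p.-tuple R) -> R) :
  measurable_fun setT F ->
  (forall x y, (forall i l, i \in A -> tnth (tnth x i) l <= tnth (tnth y i) l) ->
    F x <= F y) ->
  nondecreasing_args coord2 (F \o @extend k p A).
Proof.
move=> mF Fm; apply/nondecreasing_coord2P; split.
  by apply: measurableT_comp mF _; exact: measurable_extend.
move=> x y xy; apply: Fm => i l iA; rewrite !tnth_mktuple.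
have iA' : (index i (enum A) < #|A|)%N by rewrite cardE index_mem mem_enum.
have := xy (Ordinal iA') l.
by rewrite !(tnth_nth [tuple 0 | l < p]).
Qed.

Lemma NA_bounded_NA k p (X : 'I_k -> Omega -> p.-tuple R) :
  negatively_associated P X -> bounded_NA P (joined X).
Proof.
move=> [mX naX] A1 A2 A12 F1 F2 tF1 tF2.
(* The two tuples agree on [A], so monotonicity in the coordinates of [A] applies in both directions
   and the padding does not affect [F]. *)
have FE A F w : bounded_test A F ->
    F (extend (subfamily X A w)) = F (joined X w).
  move=> [_ _ _ Fm]; apply/eqP; rewrite eq_le; apply/andP; split;
    by apply: Fm => i l iA; rewrite tnth_extend_subfamily // tnth_mktuple.
have LF A F : bounded_test A F -> (F \o joined X) \in Lfun P 1.
  move=> [mF F0 [M FM] _]; apply: (@bounded_Lfun1 _ _ _ _ _ M).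
    by apply: measurableT_comp mF _; exact: measurable_joined.
  by move=> w; rewrite /= ger0_norm.
have LF12 : ((F1 \o joined X) \* (F2 \o joined X)) \in Lfun P 1.
  have [mF1 F10 [M1 FM1] _] := tF1; have [mF2 F20 [M2 FM2] _] := tF2.
  apply: (@bounded_Lfun1 _ _ _ _ _ (M1 * M2)).
    by apply: measurable_funM; apply: measurableT_comp => //;
      exact: measurable_joined.
  by move=> w; rewrite /= ger0_norm ?mulr_ge0 // ler_pM.
have ndF A F (tF : bounded_test A F) : nondecreasing_args coord2 (F \o @extend k p A).
  by have [mF _ _ Fm] := tF; exact: nondecreasing_extend.
have := naX _ _ A12 _ _ (ndF _ _ tF1) (ndF _ _ tF2).
have E1 : (F1 \o @extend k p A1) \o subfamily X A1 = F1 \o joined X.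
  by apply: funext => w /=; exact: FE.
have E2 : (F2 \o @extend k p A2) \o subfamily X A2 = F2 \o joined X.
  by apply: funext => w /=; exact: FE.
rewrite /= E1 E2 => /(_ (LF _ _ tF1) (LF _ _ tF2) LF12).
rewrite (covarianceE (LF _ _ tF1) (LF _ _ tF2) LF12).
by rewrite sube_le0 unlock.
Qed.

Definition clip (n : nat) (r : R) := Num.max (- n%:R) (Num.min n%:R r).

Lemma clip_le n : {homo clip n : x y / x <= y}.
Proof. by move=> x y xy; rewrite /clip; apply: le_max2 => //; apply: le_min2. Qed.

Lemma norm_clip n r : `|clip n r| <= n%:R.
Proof.
have n0 : 0 <= n%:R :> R by [].
rewrite /clip ler_norml le_max lexx /= ge_max ge_min lexx /= andbT.
by rewrite (le_trans _ n0) // oppr_le0.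
Qed.

Lemma norm_clip_le n r : `|clip n r| <= `|r|.
Proof.
have n0 : 0 <= n%:R :> R by [].
have r1 := ler_norm r; have := ler_norm (- r); rewrite normrN => r2.
rewrite /clip ler_norml; case: (leP n%:R r) => nr;
  case: (leP (- n%:R) _) => nr'; apply/andP; lra.
Qed.

Lemma measurable_clip n : measurable_fun setT (clip n).
Proof. by apply: measurable_maxr => //; apply: measurable_minr. Qed.

Lemma cvg_clip r : clip n r @[n --> \oo] --> r.
Proof.
apply: cvg_near_cst; near=> n.
have : `|r| <= n%:R by near: n; exact: nbhs_infty_ger.
rewrite /clip ler_norml => /andP[rn nr].
by rewrite min_r // max_r.
Unshelve. all: by end_near. Qed.

Lemma dominated_expectation (Y : Omega -> R) (Y_ : nat -> Omega -> R) :
  Y \in Lfun P 1 -> (forall n, measurable_fun setT (Y_ n)) ->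
  (forall n w, `|Y_ n w| <= `|Y w|) ->
  (forall w, Y_ n w @[n --> \oo] --> Y w) ->
  'E_P[Y_ n]%E @[n --> \oo] --> 'E_P[Y]%E.
Proof.
move=> LY mY_ YY cY; rewrite unlock.
have iY := (Lfun1_integrable _ _).1 LY.
have [] // := @dominated_convergence _ _ _ P setT measurableT
  (fun n => EFin \o Y_ n) (EFin \o Y) (EFin \o Num.norm \o Y).
- by move=> n; exact/measurable_EFinP.
- exact: measurable_int iY.
- by apply: aeW => w _; apply: cvg_EFin; [near=> n|exact: cY].
- exact: integrable_norm iY.
- by apply: aeW => w n _; rewrite /= lee_fin.
Unshelve. all: by end_near. Qed.

(** Clipping at level [n] preserves monotonicity and makes the functions bounded. The inequality for
    the clipped functions then passes to the limit by dominated convergence, with [Y1], [Y2] and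
    their product as dominating variables. *)
Lemma bounded_NA_NA k p (X : 'I_k -> Omega -> p.-tuple R) :
  (forall i, measurable_fun setT (X i)) ->
  bounded_NA P (joined X) -> negatively_associated P X.
Proof.
move=> mX naX; split => // A1 A2 A12 f1 f2 ndf1 ndf2 Y1 Y2 L1 L2 L12.
have mS (A : {set 'I_k}) (f : #|A|.-tuple (p.-tuple R) -> R) :
    nondecreasing_args coord2 f -> measurable_fun setT (f \o subfamily X A).
  move=> [mf _]; apply: measurableT_comp => //.
  have -> : subfamily X A = @restrict k p A \o joined X.
    by apply: funext => w; rewrite /= restrict_joined.
  by apply: measurableT_comp; [exact: measurable_restrict|exact: measurable_joined].
have mY1 : measurable_fun setT Y1 by exact: mS.
have mY2 : measurable_fun setT Y2 by exact: mS.
(* A clipped function takes values in [-n, n]; adding [n] makes it nonnegative, as a bounded test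
   must be. *)
have test (A : {set 'I_k}) (f : #|A|.-tuple (p.-tuple R) -> R) n :
    nondecreasing_args coord2 f ->
    bounded_test A (fun z => clip n (f (restrict A z)) + n%:R).
  move=> /nondecreasing_coord2P[mf fm]; split.
  - apply: measurable_funD => //.
    apply: measurableT_comp; first exact: measurable_clip.
    by apply: measurableT_comp => //; exact: measurable_restrict.
  - move=> x; have := norm_clip n (f (restrict A x)).
    by rewrite ler_norml => /andP[? _]; lra.
  - exists (n%:R + n%:R) => x; have := norm_clip n (f (restrict A x)).
    by rewrite ler_norml => /andP[_ ?]; lra.
  - move=> x y xy; rewrite lerD2r; apply/clip_le/fm => i l.
    by rewrite !tnth_mktuple; apply: xy; exact: enum_valP.
have mclip n (Y : Omega -> R) : measurable_fun setT Y ->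
    measurable_fun setT (clip n \o Y).
  by move=> mY; apply: measurableT_comp mY; exact: measurable_clip.
have Lclip n (Y : Omega -> R) : measurable_fun setT Y -> clip n \o Y \in Lfun P 1.
  move=> mY; apply: (@bounded_Lfun1 _ _ _ _ _ n%:R); first exact: mclip.
  by move=> w; exact: norm_clip.
have Lclip2 n : ((clip n \o Y1) \* (clip n \o Y2)) \in Lfun P 1.
  apply: (@bounded_Lfun1 _ _ _ _ _ (n%:R * n%:R)).
    by apply: measurable_funM; exact: mclip.
  by move=> w; rewrite /= normrM ler_pM // norm_clip.
have clip_na n : ('E_P[((clip n \o Y1) \* (clip n \o Y2))%R] <=
    'E_P[clip n \o Y1] * 'E_P[clip n \o Y2])%E.
  have := naX _ _ A12 _ _ (test _ _ n ndf1) (test _ _ n ndf2).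
  have L1n := Lclip n _ mY1; have L2n := Lclip n _ mY2.
  have Lc (c : R) : (cst c : Omega -> R) \in Lfun P 1 by exact: Lfun_cst.
  under eq_integral do rewrite restrict_joined restrict_joined.
  under [X in (_ <= X * _)%E]eq_integral do rewrite restrict_joined.
  under [X in (_ <= _ * X)%E]eq_integral do rewrite restrict_joined.
  have -> : (\int[P]_w (clip n (f1 (subfamily X A1 w)) + n%:R)%:E =
      'E_P[((clip n \o Y1) \+ cst n%:R)%R])%E by rewrite unlock.
  have -> : (\int[P]_w (clip n (f2 (subfamily X A2 w)) + n%:R)%:E =
      'E_P[((clip n \o Y2) \+ cst n%:R)%R])%E by rewrite unlock.
  (* Undoing the shift: after expansion, both sides contain the same terms in [n] and [n * n], and
     what remains is the inequality for the clipped functions themselves. *)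
  have -> : (\int[P]_w ((clip n (f1 (subfamily X A1 w)) + n%:R) *
      (clip n (f2 (subfamily X A2 w)) + n%:R))%:E =
      'E_P[(((clip n \o Y1) \* (clip n \o Y2)) \+ n%:R \o* (clip n \o Y1) \+
         n%:R \o* (clip n \o Y2) \+ cst (n%:R * n%:R))%R])%E.
    rewrite unlock; apply: eq_integral => w _; congr EFin; rewrite /=; ring.
  rewrite !expectationD;
    first [exact: Lc | by rewrite ?rpredD ?Lfun_scale | idtac].
  rewrite !expectation_cst !expectationZl //.
  have /fineK <- := expectation_fin_num L1n.
  have /fineK <- := expectation_fin_num L2n.
  have /fineK <- := expectation_fin_num (Lclip2 n).
  by rewrite -?(EFinM, EFinD) !lee_fin; lra.
rewrite (covarianceE L1 L2 L12) sube_le0.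
apply: (@lee_cvg_to _ \oo _ _ (fun n => 'E_P[((clip n \o Y1) \* (clip n \o Y2))%R])%E
  (fun n => 'E_P[clip n \o Y1] * 'E_P[clip n \o Y2])%E).
- apply: (@dominated_expectation (Y1 \* Y2)
    (fun n => (clip n \o Y1) \* (clip n \o Y2))) => //.
  + by move=> n; apply: measurable_funM; exact: mclip.
  + by move=> n w; rewrite /= !normrM ler_pM // norm_clip_le.
  + by move=> w; apply: cvgM; exact: cvg_clip.
- apply: cvgeM.
  + by apply: mule_def_fin; exact: expectation_fin_num.
  + apply: (@dominated_expectation Y1 (fun n => clip n \o Y1)) => //.
    * by move=> n; exact: mclip.
    * by move=> n w; exact: norm_clip_le.
    * by move=> w; exact: cvg_clip.
  + apply: (@dominated_expectation Y2 (fun n => clip n \o Y2)) => //.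
    * by move=> n; exact: mclip.
    * by move=> n w; exact: norm_clip_le.
    * by move=> w; exact: cvg_clip.
- exact: nearW.
Qed.

End NA_bounded.

(** * Combining two independent negatively associated families *)

Section independent_step.
Context {R : realType} d (Omega : measurableType d) (P : probability Omega R).

Definition independent_maps d1 d2 (S1 : measurableType d1)
    (S2 : measurableType d2) (Z : Omega -> S1) (U : Omega -> S2) : Prop :=
  forall A B, measurable A -> measurable B ->
  P (Z @^-1` A `&` U @^-1` B) = (P (Z @^-1` A) * P (U @^-1` B))%E.

(** Independence makes the joint law of [(Z, U)] the product of the two laws; Tonelli and a change
    of variables in each factor give the iterated integral. *)
Lemma ge0_integral_independent d1 d2 (S1 : measurableType d1)
    (S2 : measurableType d2) (Z : {mfun Omega >-> S1}) (U : {mfun Omega >-> S2})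
    (f : S1 * S2 -> \bar R) :
  independent_maps Z U -> measurable_fun setT f -> (forall x, 0 <= f x)%E ->
  (\int[P]_w f (Z w, U w) = \int[P]_w' \int[P]_w f (Z w, U w'))%E.
Proof.
move=> ZU mf f0.
have mZU : measurable_fun setT (fun w => (Z w, U w)).
  by apply: measurable_fun_pair; exact: measurable_funPT.
pose ZU' : {mfun Omega >-> (S1 * S2)%type} :=
  HB.pack (fun w => (Z w, U w)) (isMeasurableFun.Build _ _ _ _ _ mZU).
transitivity (\int[distribution P ZU']_z f z)%E.
  by rewrite ge0_integral_distribution.
transitivity (\int[(distribution P Z \x distribution P U)%E]_z f z)%E.
  (* A measure with the product values on rectangles is the product measure; on rectangles the
     equality is exactly [ZU]. *)
  by apply: eq_measure_integral => A mA _; apply/esym/product_measure_unique.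
rewrite fubini_tonelli2 // ge0_integral_distribution; first last.
- by move=> y; apply: integral_ge0.
- exact: measurable_fun_fubini_tonelli_G.
apply: eq_integral => w _; rewrite /= /fubini_G ge0_integral_distribution //.
exact: measurableT_comp.
Qed.

(** With [U] frozen, sections of the tests are tests for [Z]; their averages over [Z] are tests for
    [U]. Both keep the index sets [A1] and [A2], because the [i]-th output reads only the [i]-th
    entries of [Z] and [U]. *)
Lemma bounded_NA_coordinatewise k p q r
    (Z : {mfun Omega >-> k.-tuple (p.-tuple R)})
    (U : {mfun Omega >-> k.-tuple (q.-tuple R)})
    (phi : 'I_k -> p.-tuple R * q.-tuple R -> r.-tuple R) :
  independent_maps Z U ->
  (forall i, measurable_fun setT (phi i)) ->
  (forall i x y u v, (forall l, tnth x l <= tnth y l) ->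
     (forall l, tnth u l <= tnth v l) ->
     forall l, tnth (phi i (x, u)) l <= tnth (phi i (y, v)) l) ->
  bounded_NA P Z -> bounded_NA P U ->
  bounded_NA P (joined (fun i w => phi i (tnth (Z w) i, tnth (U w) i))).
Proof.
move=> ZU mphi phi_le naZ naU A1 A2 A12 F1 F2 tF1 tF2.
pose Phi (zu : k.-tuple (p.-tuple R) * k.-tuple (q.-tuple R)) :=
  [tuple phi i (tnth zu.1 i, tnth zu.2 i) | i < k].
have mPhi : measurable_fun setT Phi.
  apply/measurable_fun_tnthP => i.
  apply: (eq_measurable_fun (fun zu : k.-tuple (p.-tuple R) * k.-tuple (q.-tuple R)
      => phi i (tnth zu.1 i, tnth zu.2 i))).
    by move=> zu _; rewrite /= tnth_mktuple.
  apply: measurableT_comp => //; apply: measurable_fun_pair.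
    exact: (measurableT_comp (measurable_tnth i) measurable_fst).
  exact: (measurableT_comp (measurable_tnth i) measurable_snd).
have Phi_le z z' u u' i : (forall l, tnth (tnth z i) l <= tnth (tnth z' i) l) ->
    (forall l, tnth (tnth u i) l <= tnth (tnth u' i) l) ->
    forall l, tnth (tnth (Phi (z, u)) i) l <= tnth (tnth (Phi (z', u')) i) l.
  by move=> zz' uu' l; rewrite !tnth_mktuple; exact: phi_le.
have fubini (F : k.-tuple (r.-tuple R) -> R) : measurable_fun setT F ->
    (forall x, 0 <= F x) ->
    (\int[P]_w (F (Phi (Z w, U w)))%:E =
     \int[P]_w' \int[P]_w (F (Phi (Z w, U w')))%:E)%E.
  move=> mF F0.
  apply: (@ge0_integral_independent _ _ _ _ _ _ (fun zu => (F (Phi zu))%:E)) => //.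
    by apply/measurable_EFinP; exact: measurableT_comp.
  by move=> zu; rewrite lee_fin.
(* Conditional mean of the test given [U = u]; [fine] loses nothing since bounded tests have finite
   integrals ([test_fin]). *)
pose avg (F : k.-tuple (r.-tuple R) -> R) u :=
  fine (\int[P]_w (F (Phi (Z w, u)))%:E)%E.
have mZu (F : k.-tuple (r.-tuple R) -> R) u : measurable_fun setT F ->
    measurable_fun setT (fun w => (F (Phi (Z w, u)))%:E).
  move=> mF; apply/measurable_EFinP; apply: measurableT_comp => //.
  apply: measurableT_comp => //; apply: measurable_fun_pair => //.
have test_fin A F u : bounded_test A F ->
    (\int[P]_w (F (Phi (Z w, u)))%:E)%E \is a fin_num.
  move=> [mF F0 [M FM] _]; apply: integrable_fin_num => //.
  apply/Lfun1_integrable; apply: (@bounded_Lfun1 _ _ _ _ _ M).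
    exact/measurable_EFinP/mZu.
  by move=> w; rewrite ger0_norm.
have avgE A F u : bounded_test A F ->
    (avg F u)%:E = (\int[P]_w (F (Phi (Z w, u)))%:E)%E.
  by move=> tF; rewrite fineK //; exact: test_fin tF.
have test_avg A F : bounded_test A F -> bounded_test A (avg F).
  move=> tF; have [mF F0 [M FM] Fm] := tF; split.
  - apply: measurableT_comp => //.
    apply: (@measurable_fun_fubini_tonelli_G _ _ _ _ _ P
      (fun wu => (F (Phi (Z wu.1, wu.2)))%:E)); last by move=> x; rewrite lee_fin.
    apply/measurable_EFinP; apply: measurableT_comp => //.
    apply: measurableT_comp => //; apply: measurable_fun_pair => //.
    exact: measurableT_comp.
  - by move=> u; apply: fine_ge0; apply: integral_ge0 => w _; rewrite lee_fin.
  - exists M => u; rewrite -lee_fin (avgE _ _ _ tF).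
    have <- : (\int[P]_w (cst M%:E) w = M%:E)%E.
      by rewrite integral_cst //= probability_setT mule1.
    apply: ge0_le_integral => //.
    + by move=> w _; rewrite lee_fin.
    + exact: mZu.
    + by move=> w _; rewrite lee_fin.
  - move=> u v uv; rewrite -lee_fin !(avgE _ _ _ tF).
    apply: ge0_le_integral => //.
    + by move=> w _; rewrite lee_fin.
    + exact: mZu.
    + exact: mZu.
    + move=> w _; rewrite lee_fin; apply: Fm => i l iA.
      by apply: Phi_le => // l'; exact: uv.
have test_section A F u : bounded_test A F -> bounded_test A (fun z => F (Phi (z, u))).
  move=> [mF F0 [M FM] Fm]; split => //.
  - exact: (measurable_fun_pair1 u (measurableT_comp mF mPhi)).
  - by exists M.
  - by move=> z z' zz'; apply: Fm => i l iA; apply: Phi_le => // l'; exact: zz'.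
have [mF1 F10 _ _] := tF1; have [mF2 F20 _ _] := tF2.
have mF12 : measurable_fun setT (fun x => F1 x * F2 x) by exact: measurable_funM.
rewrite -[joined _]/(fun w => Phi (Z w, U w)).
rewrite (fubini (fun x => F1 x * F2 x)) //; last by move=> x; rewrite mulr_ge0.
rewrite !fubini //.
(* The middle term is the mean of the product of the conditional means: it is bounded above by
   [naU], and bounds the left side by [naZ] applied at each fixed value of [U]. *)
apply: (@le_trans _ _ (\int[P]_w (avg F1 (U w) * avg F2 (U w))%:E)%E); last first.
  apply: le_trans (naU _ _ A12 _ _ (test_avg _ _ tF1) (test_avg _ _ tF2)) _.
  under eq_integral do rewrite (avgE _ _ _ tF1).
  by under [X in (_ * X <= _)%E]eq_integral do rewrite (avgE _ _ _ tF2).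
have [mavg1 avg10 _ _] := test_avg _ _ tF1.
have [mavg2 avg20 _ _] := test_avg _ _ tF2.
apply: ge0_le_integral => //.
- by move=> w _; apply: integral_ge0 => w' _; rewrite lee_fin mulr_ge0.
- apply: (@measurableT_comp _ _ _ _ _ _
    (fun u => \int[P]_w (F1 (Phi (Z w, u)) * F2 (Phi (Z w, u)))%:E)%E) => //.
  apply: (@measurable_fun_fubini_tonelli_G _ _ _ _ _ P (fun wu =>
    (F1 (Phi (Z wu.1, wu.2)) * F2 (Phi (Z wu.1, wu.2)))%:E)).
    apply/measurable_EFinP; apply: (measurableT_comp mF12).
    apply: measurableT_comp => //; apply: measurable_fun_pair => //.
    exact: measurableT_comp.
  by move=> x; rewrite lee_fin mulr_ge0.
- by apply/measurable_EFinP; apply: measurable_funM; exact: measurableT_comp.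
- move=> w _; rewrite EFinM (avgE _ _ _ tF1) (avgE _ _ _ tF2).
  exact: (naZ _ _ A12 _ _ (test_section _ _ (U w) tF1) (test_section _ _ (U w) tF2)).
Qed.

End independent_step.

(** * Independence of the past and the next innovation *)

Section independence.
Context {R : realType} d (Omega : measurableType d) (P : probability Omega R).

(** For fixed [B], the finite measures sending [A] to P(A and B) and to P(A) P(B) agree on the
    pi-system [G], hence on the sigma-algebra it generates. *)
Lemma independent2_g_sigma_algebra (G F : set_system Omega) :
  G `<=` measurable -> F `<=` measurable -> setI_closed G -> G setT ->
  independent2 P G F -> independent2 P <<s G >> F.
Proof.
move=> Gm Fm GI GT indep A B GA FB; have mB := Fm _ FB.
pose r := NngNum (fine_ge0 (measure_ge0 P B)).
transitivity (mscale r P A); last first.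
  by rewrite /mscale /= fineK ?fin_num_measure // muleC.
rewrite -[LHS]/(mrestr P mB A).
apply: (g_sigma_algebra_measure_unique G Gm (fun=> setT)) => //.
- by rewrite bigcup_const //; exists 0%N.
- move=> C GC; rewrite -[LHS]/(P (C `&` B)) -[RHS]/((fine (P B))%:E * P C)%E.
  by rewrite indep // fineK ?fin_num_measure // muleC.
- move=> _; rewrite -[ltLHS]/(P (setT `&` B)) setTI.
  by rewrite (le_lt_trans (probability_le1 P mB)) ?ltry.
Qed.

Lemma g_sigma_algebra_sub_measurable (G : set_system Omega) :
  G `<=` measurable -> <<s G >> `<=` measurable.
Proof. by apply: smallest_sub; exact: sigma_algebra_measurable. Qed.

Lemma independent2_maps (G F : set_system Omega) d1 d2 (S1 : measurableType d1)
    (S2 : measurableType d2) (Z : Omega -> S1) (U : Omega -> S2) :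
  independent2 P <<s G >> <<s F >> ->
  measurable_fun [set: g_sigma_algebraType G] Z ->
  measurable_fun [set: g_sigma_algebraType F] U ->
  independent_maps P Z U.
Proof.
move=> indep mZ mU A B mA mB; apply: indep.
  by have := mZ measurableT _ mA; rewrite setTI.
by have := mU measurableT _ mB; rewrite setTI.
Qed.

Section past.
Variables (T : nat) (G0 GH : set_system Omega) (G : 'I_T -> set_system Omega).
Hypotheses (GH_sub : forall i, <<s G i >> `<=` <<s GH >>).
Hypotheses (mG0 : G0 `<=` measurable) (mGH : GH `<=` measurable).
Hypotheses (indG : mutually_independent P (fun i => <<s G i >>)).
Hypotheses (indH : independent2 P <<s G0 >> <<s GH >>).

(** A pi-system generating the history up to time [s], rather than the sigma-algebra itself. Index
    [i] of ['I_T] stands for time [i.+1], so [i < s] selects the innovations of times 1 to [s]. *)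
Definition past (s : nat) : set_system Omega := [set D | exists A B,
  [/\ <<s G0 >> A, forall i, <<s G i >> (B i) &
      D = A `&` \bigcap_(i in [set i : 'I_T | (i < s)%N]) B i]].

Lemma past_bigcap (D : set 'I_T) (B : 'I_T -> set Omega) :
  (forall i, <<s G i >> (B i)) -> <<s GH >> (\bigcap_(i in D) B i).
Proof.
move=> GB; apply: (@fin_bigcap_measurable _ (g_sigma_algebraType GH)) => [|i _].
  exact: finite_finset.
by apply: GH_sub; exact: GB.
Qed.

Lemma past_measurable s : past s `<=` measurable.
Proof.
move=> _ [A [B [GA GB ->]]]; apply: measurableI.
  exact: g_sigma_algebra_sub_measurable GA.
by apply: (g_sigma_algebra_sub_measurable mGH); exact: past_bigcap.
Qed.

Lemma past_setI s : setI_closed (past s).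
Proof.
move=> _ _ [A [B [GA GB ->]]] [A' [B' [GA' GB' ->]]].
exists (A `&` A'), (fun i => B i `&` B' i); split.
- exact: (@measurableI _ (g_sigma_algebraType G0)).
- by move=> i; exact (@measurableI _ (g_sigma_algebraType (G i)) _ _ (GB i) (GB' i)).
- by rewrite setIACA bigcapI.
Qed.

Lemma past_initial s : <<s G0 >> `<=` past s.
Proof.
move=> A GA; exists A, (fun=> setT); split => //.
  by move=> i; exact: (@measurableT _ (g_sigma_algebraType (G i))).
by apply/seteqP; split => [w|w []].
Qed.

Lemma past_step s (i : 'I_T) : (i < s)%N -> <<s G i >> `<=` past s.
Proof.
move=> si B GB; exists setT, (fun j => if j == i then B else setT); split.
- exact: (@measurableT _ (g_sigma_algebraType G0)).
- move=> j; case: eqP => [->//|_].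
  exact: (@measurableT _ (g_sigma_algebraType (G j))).
- rewrite setTI eqEsubset; split => [w Bw j /= _|w /(_ i si)].
    by case: eqP.
  by rewrite eqxx.
Qed.

(** By the pi-system criterion it suffices to treat an initial event, finitely many earlier
    innovation events and an event [C] of index [s]. The initial event splits off by [indH], and
    [indG] factors the rest. *)
Lemma independent_past (s : 'I_T) : independent2 P <<s past s >> <<s G s >>.
Proof.
apply: independent2_g_sigma_algebra.
- exact: past_measurable.
- by move=> A /GH_sub; exact: g_sigma_algebra_sub_measurable.
- exact: past_setI.
- by apply: past_initial; exact: (@measurableT _ (g_sigma_algebraType G0)).
move=> _ C [A [B [GA GB ->]]] GC.
pose J : {set 'I_T} := [set i : 'I_T | (i < s)%N]%SET.
have JE : [set i : 'I_T | (i < s)%N] = [set` J].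
  by apply/seteqP; split => i /=; rewrite inE.
have sJ : s \notin J by rewrite inE ltnn.
(* Inserting [C] at index [s] turns the innovation events and [C] into one family over [s |: J], to
   which mutual independence applies. *)
pose B' i := if i == s then C else B i.
have GB' i : <<s G i >> (B' i) by rewrite /B'; case: eqP => [->|].
have BB' i : i \in J -> B' i = B i.
  by rewrite /B' inE; case: eqP => // ->; rewrite ltnn.
have capJ : \bigcap_(i in [set` J]) B i `&` C = \bigcap_(i in [set` s |: J]) B' i.
  rewrite eqEsubset; split=> [w [Bw Cw] i /=|w Bw].
    rewrite in_setU1 => /orP[/eqP ->|iJ]; first by rewrite /B' eqxx.
    by rewrite BB' //; exact: Bw.
  split=> [i /= iJ|]; last first.
    by have := Bw s; rewrite /B' eqxx; apply; rewrite /= setU11.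
  by rewrite -BB' //; apply: Bw; rewrite /= in_setU1 iJ orbT.
(* [indH] is used twice, with and without [C]; the two products given by [indG] then differ by the
   factor P(C). *)
rewrite JE -setIA capJ indH //; last exact: past_bigcap.
have B's : B' s = C by rewrite /B' eqxx.
rewrite indG // big_setU1 //= B's indH //; last exact: past_bigcap.
rewrite indG //; under eq_bigr => i iJ do rewrite BB' //.
by rewrite muleCA [RHS]muleC.
Qed.
End past.

End independence.

(** * Negative association along the chains *)

Section chain_NA.
Context {R : realType} d (Omega : measurableType d) (P : probability Omega R).

(** The generating family inside [generated_sigma_algebra], isolated so that it can serve as an
    argument of [past] and [g_sigma_algebraType]. *)
Definition generators (I : Type) (p : I -> nat)
    (V : forall i, Omega -> (p i).-tuple R) : set_system Omega :=
  \bigcup_i preimage_set_system [set: Omega] (V i) measurable.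

Lemma generators_sub_measurable (I : Type) (p : I -> nat)
    (V : forall i, {RV P >-> (p i).-tuple R}) :
  generators V `<=` measurable.
Proof. by move=> A [i _ [B mB <-]]; exact: measurable_funPT. Qed.

Lemma measurable_fun_of_sub (G : set_system Omega) d' (S : measurableType d')
    (f : Omega -> S) : G `<=` measurable ->
  measurable_fun [set: g_sigma_algebraType G] f -> measurable_fun setT f.
Proof.
move=> Gm mf _ B mB; apply: (g_sigma_algebra_sub_measurable Gm).
exact: mf measurableT _ mB.
Qed.

Context (k T p : nat) (q : nat -> nat)
  (psi : forall t, p.-tuple R * (q t).-tuple R -> p.-tuple R)
  (X0 : 'I_k -> {RV P >-> p.-tuple R})
  (U : forall t, 'I_k -> {RV P >-> (q t).-tuple R}).
Arguments psi : clear implicits.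
Hypothesis hU_indep : mutually_independent P
  (fun t : 'I_T => generated_sigma_algebra (U t.+1)).
Hypothesis hU_NA : forall t, (1 <= t <= T)%N -> negatively_associated P (U t).
Hypothesis hX0_indep : independent2 P (generated_sigma_algebra X0)
  (generated_sigma_algebra (fun tj : 'I_T * 'I_k => U tj.1.+1 tj.2)).
Hypothesis hpsi : forall t, (1 <= t <= T)%N -> forall l : 'I_p,
  nondecreasing_args coord_pair (fun xu => tnth (psi t xu) l).

Let X := chain psi X0 U.
Let pastX := past (generators X0) (fun t : 'I_T => generators (U t.+1)).
Let genU := generators (fun tj : 'I_T * 'I_k => U tj.1.+1 tj.2).

Let genU_sub (t : 'I_T) : <<s generators (U t.+1) >> `<=` <<s genU >>.
Proof.
apply: sub_smallest2r; first exact: smallest_sigma_algebra.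
by move=> A [j _ Aj]; exists (t, j).
Qed.

Let genX0_measurable : generators X0 `<=` measurable.
Proof. exact: generators_sub_measurable. Qed.

Let genU_measurable : genU `<=` measurable.
Proof.
exact: (@generators_sub_measurable _ (fun tj : 'I_T * 'I_k => q tj.1.+1)
  (fun tj => U tj.1.+1 tj.2)).
Qed.

Let pastX_measurable s : pastX s `<=` measurable.
Proof. exact: (past_measurable genU_sub genX0_measurable genU_measurable). Qed.

Lemma measurable_psi t : (1 <= t <= T)%N -> measurable_fun setT (psi t).
Proof.
move=> tT; apply/measurable_fun_tnthP => l.
by have [] := hpsi tT l.
Qed.

(** By induction on [t], the state at time [t] is built from the initial state and the innovations
    up to [t], all of which belong to the history up to [s]. *)
Lemma measurable_chain_past s t j : (t <= s <= T)%N ->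
  measurable_fun [set: g_sigma_algebraType (pastX s)] (X t j).
Proof.
elim: t => [|t IH] /andP[ts sT].
  move=> _ B mB; apply: sub_sigma_algebra; apply: past_initial.
  by apply: sub_sigma_algebra; exists j => //; exists B.
have tT : (t < T)%N := leq_trans ts sT.
apply: (measurableT_comp (measurable_psi (_ : (1 <= t.+1 <= T)%N))) => //.
apply: measurable_fun_pair; first by apply: IH; rewrite (ltnW ts).
move=> _ B mB; apply: sub_sigma_algebra;
  (* The innovation of time [t.+1] carries the index [t], and [t < s] holds. *)
  apply: (@past_step _ _ _ _ _ _ (Ordinal tT)) => //.
by apply: sub_sigma_algebra; exists j => //; exists B.
Qed.

Lemma measurable_chain t j : (t <= T)%N -> measurable_fun setT (X t j).
Proof.
move=> tT; apply: (measurable_fun_of_sub (@pastX_measurable t)).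
by apply: measurable_chain_past; rewrite leqnn.
Qed.

(** Induction on the truncation level [s]: all chains start at time 0, and each level adds one
    innovation family, independent of the history that determines the previous level. *)
Lemma chain_bounded_NA (t : 'I_k -> nat) s : (s <= T)%N ->
  bounded_NA P (joined X0) ->
  bounded_NA P (joined (fun j => X (minn (t j) s) j)).
Proof.
move=> sT naX0; elim: s sT => [|s IH] sT.
  have -> // : (fun j => X (minn (t j) 0) j) = (fun j => X0 j).
  by apply: funext => j; rewrite minn0.
pose W := joined (fun j => X (minn (t j) s) j).
pose V := joined (U s.+1).
have mW : measurable_fun [set: g_sigma_algebraType (pastX s)] W.
  apply: measurable_joined => j; apply: measurable_chain_past.
  by rewrite geq_minr ltnW.
have mV : measurable_fun [set: g_sigma_algebraType (generators (U s.+1))] V.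
  apply: measurable_joined => j _ B mB; apply: sub_sigma_algebra.
  by exists j => //; exists B.
pose W' : {mfun Omega >-> k.-tuple (p.-tuple R)} := HB.pack W
  (isMeasurableFun.Build _ _ _ _ _ (measurable_fun_of_sub (@pastX_measurable s) mW)).
pose V' : {mfun Omega >-> k.-tuple ((q s.+1).-tuple R)} := HB.pack V
  (isMeasurableFun.Build _ _ _ _ _
    (measurable_fun_of_sub (@generators_sub_measurable _ _ (U s.+1)) mV)).
(* A chain that has not reached its target time [t j] makes a step; the others stay where they are,
   by the first projection, which is also nondecreasing. *)
pose phi j (xu : p.-tuple R * (q s.+1).-tuple R) :=
  if (s < t j)%N then psi s.+1 xu else xu.1.
have -> : joined (fun j => X (minn (t j) s.+1) j) =
    joined (fun j w => phi j (tnth (W' w) j, tnth (V' w) j)).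
  apply: funext => w; apply: eq_from_tnth => j; rewrite !tnth_mktuple /phi.
  case: ltnP => st /=; first by rewrite (minn_idPr st).
  by rewrite (minn_idPl (leqW st)).
apply: bounded_NA_coordinatewise.
- apply: (independent2_maps _ mW mV).
  exact: (@independent_past _ _ _ _ _ _ _ _ genU_sub genX0_measurable
    genU_measurable hU_indep hX0_indep (Ordinal sT)).
- move=> j; rewrite /phi; case: ltnP => _; [exact: (@measurable_psi s.+1)|].
  exact: measurable_fst.
- move=> j x y u v xy uv l; rewrite /phi; case: ltnP => _ //.
  by have /nondecreasing_coord_pairP[_] := @hpsi s.+1 sT l; apply.
- exact: IH (ltnW sT).
- by apply: NA_bounded_NA; exact: hU_NA.
Qed.

Lemma chain_NA (t : 'I_k -> nat) : (forall j, t j <= T)%N ->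
  negatively_associated P X0 -> negatively_associated P (fun j => X (t j) j).
Proof.
move=> tT naX0; apply: bounded_NA_NA; first by move=> j; exact: measurable_chain.
have -> : (fun j => X (t j) j) = (fun j => X (minn (t j) T) j).
  by apply: funext => j; rewrite (minn_idPl (tT j)).
by apply: chain_bounded_NA => //; exact: NA_bounded_NA.
Qed.

End chain_NA.

(** * Covariances of time sums and the variance reduction factor *)

Section variance_reduction.
Context {R : realType} d (Omega : measurableType d) (P : probability Omega R).

(** The variance is the integral of the squared deviation from the real number [c], so its
    finiteness puts [Y - c] in L2; adding the constant back gives [Y]. *)
Lemma finite_variance_Lfun2 (Y : Omega -> R) : measurable_fun setT Y ->
  ('V_P[Y] < +oo)%E -> Y \in Lfun P 2%:E.
Proof.
move=> mY; set c := fine 'E_P[Y]; rewrite /variance unlock unlock => VY.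
have LZ : (Y \- cst c) \in Lfun P 2%:E.
  rewrite inE; apply/andP; split; rewrite inE /=; first exact: measurable_funB.
  rewrite /finite_norm unlock poweR_lty //=; apply: le_lt_trans VY.
  under eq_integral do rewrite powR_mulrn // real_normK ?num_real // expr2.
  by rewrite /c unlock; exact: lexx.
have -> : Y = (Y \- cst c) \+ cst c by apply: funext => w /=; rewrite subrK.
by rewrite rpredD ?lee1n // => ?; exact: Lfun_cst.
Qed.

Lemma Lfun2_Lfun1 (Y : Omega -> R) : Y \in Lfun P 2%:E -> Y \in Lfun P 1.
Proof. by apply: Lfun_subset12; exact: fin_num_measure. Qed.

Lemma Lfun2_time_sum T (Y : nat -> Omega -> R) :
  (forall t, (1 <= t <= T)%N -> Y t \in Lfun P 2%:E) ->
  time_sum T Y \in Lfun P 2%:E.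
Proof.
move=> LY.
have -> : time_sum T Y = \sum_(1 <= t < T.+1) Y t.
  by apply: funext => w; rewrite fct_sumE.
by rewrite big_nat rpred_sum ?lee1n // => ? t tT; exact: LY.
Qed.

Lemma covariance_time_suml T (Y : nat -> Omega -> R) Z :
  (forall t, (1 <= t <= T)%N -> Y t \in Lfun P 2%:E) -> Z \in Lfun P 2%:E ->
  covariance P (time_sum T Y) Z = (\sum_(1 <= t < T.+1) covariance P (Y t) Z)%E.
Proof.
move=> LY LZ; elim: T LY => [|T IH] LY.
  rewrite big_geq //.
  have -> : time_sum 0 Y = cst 0.
    by apply: funext => w; rewrite /time_sum big_geq.
  exact: covariance_cst_l.
have LY' t : (1 <= t <= T)%N -> Y t \in Lfun P 2%:E.
  by move=> /andP[t0 tT]; rewrite LY // t0 leqW.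
rewrite big_nat_recr //= -IH // -covarianceDl //; last 2 first.
- exact: Lfun2_time_sum.
- by rewrite LY // leqnn.
congr (covariance P _ Z); apply: funext => w.
by rewrite /time_sum big_nat_recr.
Qed.

Lemma covariance_time_sum T (Y Z : nat -> Omega -> R) :
  (forall t, (1 <= t <= T)%N -> Y t \in Lfun P 2%:E) ->
  (forall t, (1 <= t <= T)%N -> Z t \in Lfun P 2%:E) ->
  covariance P (time_sum T Y) (time_sum T Z) =
  (\sum_(1 <= t < T.+1) \sum_(1 <= s < T.+1) covariance P (Y t) (Z s))%E.
Proof.
move=> LY LZ; rewrite covariance_time_suml //; last exact: Lfun2_time_sum.
rewrite !big_nat; apply: eq_bigr => t tT.
rewrite covarianceC covariance_time_suml //; last exact: LY.
by apply: eq_bigr => s _; rewrite covarianceC.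
Qed.

(** The factor is 1 + N / D with D > 0 and N a sum of nonpositive covariances; such a sum is
    negative exactly when one of its terms is. *)
Lemma variance_reduction_le1 (k T : nat) (Y : nat -> 'I_k -> Omega -> R) :
  (forall t j, (1 <= t <= T)%N -> Y t j \in Lfun P 2%:E) ->
  (forall t1 t2 j1 j2, (1 <= t1 <= T)%N -> (1 <= t2 <= T)%N -> j1 != j2 ->
    (covariance P (Y t1 j1) (Y t2 j2) <= 0)%E) ->
  (0 < \sum_(j < k) 'V_P[time_sum T (Y ^~ j)])%E ->
  variance_reduction_factor P T Y <= 1 /\
  (variance_reduction_factor P T Y < 1 <->
   exists (t1 t2 : nat) (j1 j2 : 'I_k),
     [/\ (1 <= t1 <= T)%N, (1 <= t2 <= T)%N, j1 != j2 &
         (covariance P (Y t1 j1) (Y t2 j2) < 0)%E]).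
Proof.
move=> LY covY V_gt0.
pose c t1 t2 j1 j2 := fine (covariance P (Y t1 j1) (Y t2 j2)).
have cov_fin t1 t2 j1 j2 : (1 <= t1 <= T)%N -> (1 <= t2 <= T)%N ->
    covariance P (Y t1 j1) (Y t2 j2) \is a fin_num.
  move=> t1T t2T; have L1 := LY t1 j1 t1T; have L2 := LY t2 j2 t2T.
  exact: (covariance_fin_num (Lfun2_Lfun1 L1) (Lfun2_Lfun1 L2)
    (Lfun2_mul_Lfun1 L1 L2)).
have cE t1 t2 j1 j2 : (1 <= t1 <= T)%N -> (1 <= t2 <= T)%N ->
    (c t1 t2 j1 j2)%:E = covariance P (Y t1 j1) (Y t2 j2).
  by move=> t1T t2T; rewrite fineK // cov_fin.
have c_le0 t1 t2 j1 j2 : (1 <= t1 <= T)%N -> (1 <= t2 <= T)%N -> j1 != j2 ->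
    c t1 t2 j1 j2 <= 0.
  by move=> t1T t2T j12; rewrite -lee_fin cE // covY.
have LS j : time_sum T (Y ^~ j) \in Lfun P 2%:E.
  by apply: Lfun2_time_sum => t tT; exact: LY.
have SE j1 j2 : fine (covariance P (time_sum T (Y ^~ j1)) (time_sum T (Y ^~ j2))) =
    \sum_(1 <= t < T.+1) \sum_(1 <= s < T.+1) c t s j1 j2.
  rewrite covariance_time_sum; [|by move=> t tT; exact: LY..].
  apply: EFin_inj; rewrite fineK; last first.
    rewrite big_nat; apply/sum_fin_numP => t _ tT.
    by rewrite big_nat; apply/sum_fin_numP => s _ sT; exact: cov_fin.
  rewrite -sumEFin !big_nat; apply: eq_bigr => t tT.
  by rewrite -sumEFin !big_nat; apply: eq_bigr => s sT; rewrite cE.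
have S_le0 j1 j2 : j1 != j2 ->
    \sum_(1 <= t < T.+1) \sum_(1 <= s < T.+1) c t s j1 j2 <= 0.
  move=> j12; rewrite big_nat; apply: sumr_le0 => t tT.
  by rewrite big_nat; apply: sumr_le0 => s sT; exact: c_le0.
pose D := \sum_(j < k) fine 'V_P[time_sum T (Y ^~ j)].
have D_gt0 : 0 < D.
  rewrite -lte_fin -sumEFin; under eq_bigr do rewrite fineK ?variance_fin_num //.
  exact: V_gt0.
pose N := \sum_(j1 < k) \sum_(j2 < k | j1 != j2)
  \sum_(1 <= t < T.+1) \sum_(1 <= s < T.+1) c t s j1 j2.
have -> : variance_reduction_factor P T Y = 1 + N / D.
  rewrite /variance_reduction_factor -/D; congr (1 + _ / _).
  by apply: eq_bigr => j1 _; apply: eq_bigr => j2 _; exact: SE.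
have N_le0 : N <= 0.
  by apply: sumr_le0 => j1 _; apply: sumr_le0 => j2; exact: S_le0.
rewrite gerDl gtrDl pmulr_lle0 ?invr_gt0 // pmulr_llt0 ?invr_gt0 //.
split=> //; split=> [N_lt0|[t1 [t2 [j1 [j2 [t1T t2T j12 cov_lt0]]]]]].
  (* If no between-chain covariance is negative, every term of [N] is nonnegative, against
     [N < 0]. *)
  apply: contrapT => nex; move: N_lt0; apply/negP; rewrite -leNgt.
  apply: sumr_ge0 => j1 _; apply: sumr_ge0 => j2 j12.
  rewrite big_nat; apply: sumr_ge0 => t tT.
  rewrite big_nat; apply: sumr_ge0 => s sT.
  rewrite leNgt; apply/negP => c_lt0; apply: nex; exists t, s, j1, j2.
  by split => //; rewrite -cE.
(* Used once for each of the four nested sums, to carry strict negativity from one term up to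
   [N]. *)
have sum_lt0 (I : eqType) (r : seq I) (Q : pred I) (F : I -> R) i :
    i \in r -> Q i -> (forall j, Q j -> F j <= 0) -> F i < 0 ->
    \sum_(j <- r | Q j) F j < 0.
  move=> ir Qi F0 Fi; rewrite (big_rem i) //= Qi.
  by rewrite ltr_wnDr // sumr_le0.
rewrite /N; apply: (sum_lt0 _ _ _ _ j1) => //; first exact: mem_index_enum.
  by move=> j _; apply: sumr_le0 => j'; exact: S_le0.
apply: (sum_lt0 _ _ _ _ j2) => //; first exact: mem_index_enum.
  by move=> j; exact: S_le0.
rewrite big_nat; apply: (sum_lt0 _ _ _ _ t1) => //.
- by rewrite mem_index_iota.
- move=> t tT; rewrite big_nat; apply: sumr_le0 => s sT; exact: c_le0.
rewrite big_nat; apply: (sum_lt0 _ _ _ _ t2) => //.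
- by rewrite mem_index_iota.
- by move=> s sT; exact: c_le0.
- by rewrite -lte_fin cE.
Qed.

(** Negative association is applied to the singletons of [j1] and [j2]; composing with [extend]
    makes [f] and [g] functions of one-element subfamilies. *)
Lemma NA_covariance_le0 k p (X : 'I_k -> Omega -> p.-tuple R) j1 j2
    (f g : p.-tuple R -> R) :
  negatively_associated P X -> j1 != j2 ->
  nondecreasing_args coord1 f -> nondecreasing_args coord1 g ->
  f \o X j1 \in Lfun P 2%:E -> g \o X j2 \in Lfun P 2%:E ->
  (covariance P (f \o X j1) (g \o X j2) <= 0)%E.
Proof.
move=> [_ naX] j12 ndf ndg Lf Lg.
have nd j (h : p.-tuple R -> R) : nondecreasing_args coord1 h ->
    nondecreasing_args coord2 ((fun z => h (tnth z j)) \o @extend R k p [set j]%SET).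
  move=> /nondecreasing_coord1P[mh hm]; apply: nondecreasing_extend.
    by apply: measurableT_comp => //; exact: measurable_tnth.
  by move=> x y xy; apply: hm => l; apply: xy; rewrite finset.in_set1.
have E j h : ((fun z => h (tnth z j)) \o @extend R k p [set j]%SET)
    \o subfamily X [set j]%SET = h \o X j.
  by apply: funext => w /=; rewrite tnth_extend_subfamily // finset.in_set1.
have disj : [set j1]%SET :&: [set j2]%SET = finset.set0.
  by apply/finset.setP => i; rewrite !inE; case: eqP => // ->; exact: negbTE.
have := naX _ _ disj _ _ (nd j1 _ ndf) (nd j2 _ ndg).
rewrite /= !E; apply; [exact: Lfun2_Lfun1|exact: Lfun2_Lfun1|].
exact: Lfun2_mul_Lfun1.
Qed.

Lemma nonincreasing_argsN d' (V : measurableType d') I (c : V -> I -> R)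
    (f : V -> R) : nonincreasing_args c f -> nondecreasing_args c (\- f).
Proof.
move=> [mf fm]; split; first exact: measurableT_comp.
by move=> x y i xy eqxy; rewrite /= lerN2; exact: fm xy eqxy.
Qed.

End variance_reduction.

Theorem theorem1 (d : measure_display) (Omega : measurableType d)
    (R : realType) (P : probability Omega R)
    (k T p : nat) (q : nat -> nat)
    (psi : forall t, p.-tuple R * (q t).-tuple R -> p.-tuple R)
    (X0 : 'I_k -> {RV P >-> p.-tuple R})
    (U : forall t, 'I_k -> {RV P >-> (q t).-tuple R})
    (hk : (2 <= k)%N) (hT : (1 <= T)%N)
    (hU_indep : mutually_independent P
       (fun t : 'I_T => generated_sigma_algebra (U t.+1)))
    (hU_NA : forall t, (1 <= t <= T)%N -> negatively_associated P (U t))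
    (hX0_indep : independent2 P (generated_sigma_algebra X0)
       (generated_sigma_algebra (fun tj : 'I_T * 'I_k => U tj.1.+1 tj.2)))
    (hpsi : forall t, (1 <= t <= T)%N -> forall l : 'I_p,
       nondecreasing_args coord_pair (fun xu => tnth (psi t xu) l)) :
  let X := chain psi X0 U in
  ((forall t : 'I_k -> 'I_T.+1,
      negatively_associated P (fun j => X (t j) j))
   <-> negatively_associated P (fun j => X 0%N j))
  /\
  (negatively_associated P X0 ->
   forall f : p.-tuple R -> R,
     monotone_args coord1 f ->
     let Y t j := f \o X t j in
     (forall t j, (1 <= t <= T)%N -> ('V_P[Y t j] < +oo)%E) ->
     (0 < \sum_(j < k) 'V_P[time_sum T (Y ^~ j)])%E ->
     variance_reduction_factor P T Y <= 1 /\
     (variance_reduction_factor P T Y < 1 <->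
      exists (t1 t2 : nat) (j1 j2 : 'I_k),
        [/\ (1 <= t1 <= T)%N, (1 <= t2 <= T)%N, j1 != j2 &
            (covariance P (Y t1 j1) (Y t2 j2) < 0)%E])).
Proof.
move=> X; split.
  split=> [naX|naX0 t]; first exact: (naX (fun=> ord0)).
  apply: (chain_NA hU_indep hU_NA hX0_indep hpsi _ naX0) => j.
  by rewrite -ltnS.
move=> naX0 f mono_f Y VY V_gt0.
have mf : measurable_fun setT f by case: mono_f => -[].
have LY t j : (1 <= t <= T)%N -> Y t j \in Lfun P 2%:E.
  move=> tT; apply: finite_variance_Lfun2; last exact: VY.
  apply: measurableT_comp => //.
  apply: (measurable_chain X0 U hpsi).
  by case/andP: tT.
apply: variance_reduction_le1 => // t1 t2 j1 j2 t1T t2T j12.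
(* Negative association concerns one time per chain: chain [j1] is read at [t1] and every other
   chain, in particular [j2], at [t2]. *)
pose t j := if j == j1 then t1 else t2.
have t_le j : (t j <= T)%N.
  by rewrite /t; case: eqP => _; [case/andP: t1T|case/andP: t2T].
have naXt := chain_NA hU_indep hU_NA hX0_indep hpsi t_le naX0.
have L1 := LY t1 j1 t1T; have L2 := LY t2 j2 t2T.
have X1 : X t1 j1 = X (t j1) j1 by rewrite /t eqxx.
have X2 : X t2 j2 = X (t j2) j2 by rewrite /t eq_sym (negbTE j12).
case: mono_f => [ndf|/nonincreasing_argsN ndf].
  move: L1 L2; rewrite /Y X1 X2 => L1 L2.
  exact: (NA_covariance_le0 naXt).
(* For nonincreasing [f], changing the sign of both variables keeps the covariance and makes the
   function nondecreasing. *)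
rewrite -covarianceNN; [|exact: Lfun2_Lfun1|exact: Lfun2_Lfun1|exact: Lfun2_mul_Lfun1].
move: L1 L2; rewrite /Y X1 X2 => L1 L2.
by apply: (NA_covariance_le0 naXt j12 ndf ndf); rewrite rpredN.
Qed.
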